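(* Let $\Phi$ be a logic program, $A$ an atomic formula and $y$ a term variable not occurring in $A$. Then $\Phi\vdash\{A\}\leadsto^*\emptyset$ if and only if $F(\Phi)\vdash\{A[y]\}\leadsto^*\emptyset$.
   Context: Atomic formulas $P(t_1,\dots,t_n)$ over first-order terms; a logic program is a list of closed Horn formulas $\kappa:\forall\underline{x}.B_1,\dots,B_m\Rightarrow C$ ($m\ge0$) labelled by distinct constants $\kappa$. LP-Unif reduction on multisets of atomic formulas: $\Psi\vdash\{A_1,\dots,A_i,\dots,A_n\}\leadsto\{\gamma A_1,\dots,\gamma B_1,\dots,\gamma B_m,\dots,\gamma A_n\}$ whenever $\kappa:\forall\underline{x}.B_1,\dots,B_m\Rightarrow C\in\Psi$ (quantified variables renamed apart) and $\gamma$ is a most general unifier of $C$ and $A_i$; $\leadsto^*$ is its reflexive–transitive closure. For $A\equiv P(t_1,\dots,t_n)$ and a term $t'$ whose free variables are disjoint from those of the $t_i$, $A[t']$ denotes $P(t_1,\dots,t_n,t')$. The realizability transformation $F(\Phi)$ replaces each axiom $\kappa:\forall\underline{x}.A_1,\dots,A_m\Rightarrow B$ by $\kappa:\forall\underline{x}.\forall\underline{y}.A_1[y_1],\dots,A_m[y_m]\Rightarrow B[f_\kappa(y_1,\dots,y_m)]$, where $y_1,\dots,y_m$ are fresh distinct variables and $f_\kappa$ is a new function symbol of arity $m$ associated with $\kappa$. *)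

(* Defs.v *)
From mathcomp Require Import all_boot.
From Stdlib Require Import Permutation Relation_Operators.

Set Implicit Arguments.
Unset Strict Implicit.
Unset Printing Implicit Defensive.

Record signature := Signature {
  fun_sym : eqType;
  fun_arity : fun_sym -> nat;
  pred_sym : eqType;
  pred_arity : pred_sym -> nat
}.

Inductive term (S : signature) : Type :=
| Var of nat
| App (f : fun_sym S) of {ffun 'I_(fun_arity f) -> term S}.

Arguments Var {S} _.
Arguments App {S} f _.

Record atom (S : signature) := Atom {
  pred_of : pred_sym S;
  args_of : {ffun 'I_(pred_arity pred_of) -> term S}
}.

(* The formula [label : forall x_1 ... x_k, body => head].  The formula is
   closed: every variable occurring in it is bound by the quantifier prefix,
   which is therefore not recorded. *)
Record horn (S : signature) (K : Type) := Horn {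
  label : K;
  body : seq (atom S);
  head : atom S
}.

Definition distinct_labels (S : signature) (K : eqType)
    (Phi : seq (horn S K)) : bool :=
  uniq [seq label c | c <- Phi].

Fixpoint term_vars (S : signature) (t : term S) : seq nat :=
  match t with
  | Var x => [:: x]
  | App f a => flatten [seq term_vars (a i) | i <- enum 'I_(fun_arity f)]
  end.

Definition atom_vars (S : signature) (A : atom S) : seq nat :=
  flatten [seq term_vars (args_of A i) | i <- enum 'I_(pred_arity (pred_of A))].

Definition horn_vars (S : signature) (K : Type) (c : horn S K) : seq nat :=
  flatten [seq atom_vars A | A <- head c :: body c].

Fixpoint tsubst (S : signature) (s : nat -> term S) (t : term S) : term S :=
  match t with
  | Var x => s x
  | App f a => App f [ffun i => tsubst s (a i)]
  end.

Definition asubst (S : signature) (s : nat -> term S) (A : atom S) : atom S :=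
  Atom [ffun i => tsubst s (args_of A i)].

Definition hsubst (S : signature) (K : Type) (s : nat -> term S)
    (c : horn S K) : horn S K :=
  Horn (label c) [seq asubst s B | B <- body c] (asubst s (head c)).

Definition unifier (S : signature) (s : nat -> term S) (A B : atom S) : Prop :=
  asubst s A = asubst s B.

Definition mgu (S : signature) (s : nat -> term S) (A B : atom S) : Prop :=
  unifier s A B /\
  forall d, unifier d A B ->
    exists r : nat -> term S, forall x, d x = tsubst r (s x).

Definition renamed_apart (S : signature) (K : Type) (G : seq (atom S))
    (c c' : horn S K) : Prop :=
  exists r : nat -> nat,
    [/\ injective r,
        c' = hsubst (fun x => Var (r x)) c &
        forall A, List.In A G ->
          forall x, x \in horn_vars c' -> x \notin atom_vars A].

(* Finite multisets are lists up to [Permutation]. *)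
Inductive lp_unif (S : signature) (K : Type) (Psi : seq (horn S K))
    (G G' : seq (atom S)) : Prop :=
| LpUnif (A : atom S) (R : seq (atom S)) (c c' : horn S K)
    (g : nat -> term S) of
    Permutation G (A :: R) &
    List.In c Psi &
    renamed_apart G c c' &
    mgu g (head c') A &
    Permutation G' [seq asubst g B | B <- body c' ++ R].

Definition lp_unif_star (S : signature) (K : Type) (Psi : seq (horn S K)) :
    seq (atom S) -> seq (atom S) -> Prop :=
  clos_refl_trans _ (lp_unif Psi).

(* The number of premises of the formula labelled [k] in [Phi]; the value 0 at
   labels not used in [Phi] is immaterial. *)
Definition premises (S : signature) (K : eqType) (Phi : seq (horn S K))
    (k : K) : nat :=
  nth 0 [seq size (body c) | c <- Phi] (index k [seq label c | c <- Phi]).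

(* The symbol f_k is [inr k].  Each predicate takes one more argument, since
   P(t_1, ..., t_n) becomes P(t_1, ..., t_n, t'). *)
Definition real_sig (S : signature) (K : eqType) (Phi : seq (horn S K)) :
    signature :=
  @Signature (fun_sym S + K)%type
    (fun f => match f with
              | inl g => fun_arity g
              | inr k => premises Phi k
              end)
    (pred_sym S)
    (fun P => (pred_arity P).+1).

Fixpoint embed (S : signature) (K : eqType) (Phi : seq (horn S K))
    (t : term S) : term (real_sig Phi) :=
  match t with
  | Var x => Var x
  | App f a => @App (real_sig Phi) (inl f) [ffun i => embed Phi (a i)]
  end.

(* A[t'] *)
Definition add_arg (S : signature) (K : eqType) (Phi : seq (horn S K))
    (A : atom S) (t' : term (real_sig Phi)) : atom (real_sig Phi) :=
  @Atom (real_sig Phi) (pred_of A)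
    [ffun i : 'I_(pred_arity (pred_of A)).+1 =>
       if unlift ord_max i is Some j then embed Phi (args_of A j) else t'].

(* The variable y_(i+1), chosen beyond all the variables of [c]. *)
Definition fresh_var (S : signature) (K : Type) (c : horn S K) (i : nat) : nat :=
  (\max_(x <- horn_vars c) x).+1 + i.

Definition real_horn (S : signature) (K : eqType) (Phi : seq (horn S K))
    (c : horn S K) : horn (real_sig Phi) K :=
  Horn (label c)
    [seq add_arg Bi.1 (Var (fresh_var c Bi.2))
       | Bi <- zip (body c) (iota 0 (size (body c)))]
    (add_arg (head c)
       (@App (real_sig Phi) (inr (label c))
          [ffun i : 'I_(premises Phi (label c)) => Var (fresh_var c i)])).

Definition realizability (S : signature) (K : eqType) (Phi : seq (horn S K)) :
    seq (horn (real_sig Phi) K) :=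
  [seq real_horn Phi c | c <- Phi].

(* Main.v *)
(* A goal G can be reduced to the empty one iff for some substitution s every
   atom of sG has a derivation tree built from instances of the clauses; from
   right to left this is the usual lifting argument, which rests on the
   existence of most general unifiers.  On derivation trees the realizability
   transformation is transparent: a tree for A yields a tree for A[t], where t
   is the tree itself written with the symbols f_k, and erasing the last
   argument of every atom turns a tree over F(Phi) into a tree over Phi. *)
Require Import Defs.
From mathcomp Require Import all_boot.
From mathcomp Require Import zify.
From Stdlib Require Import Permutation Relation_Operators Operators_Properties.
From Stdlib Require Import Eqdep_dec.

Set Implicit Arguments.
Unset Strict Implicit.
Unset Printing Implicit Defensive.

(** * Lists: membership, indexing and finite choice *)

Lemma in_map_inv (T U : Type) (f : T -> U) (s : seq T) (y : U) :
  List.In y (map f s) -> exists x, y = f x /\ List.In x s.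
Proof. by move/List.in_map_iff => [x [<- xs]]; exists x. Qed.

Lemma eq_in_map_In (T U : Type) (f g : T -> U) (s : seq T) :
  (forall x, List.In x s -> f x = g x) -> map f s = map g s.
Proof. exact: List.map_ext_in. Qed.

Lemma mem_flatten_map (T : Type) (U : eqType) (f : T -> seq U) (s : seq T)
    (y : U) :
  y \in flatten [seq f x | x <- s] <-> exists2 x, List.In x s & y \in f x.
Proof.
elim: s => [|x s IHs] /=; first by split=> // -[].
rewrite mem_cat; split.
  case/orP=> [fx|/IHs[z zs fz]]; first by exists x; [left|].
  by exists z; [right|].
case=> z [->|zs] fz; first by rewrite fz.
by apply/orP; right; apply/IHs; exists z.
Qed.

Lemma leq_max_mem (s : seq nat) (x : nat) : x \in s -> x <= \max_(y <- s) y.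
Proof. by move=> xs; apply: leq_bigmax_seq. Qed.

Lemma in_zip_iota (T : Type) (s : seq T) (m : nat) (p : T * nat) :
  List.In p (zip s (iota m (size s))) -> List.In p.1 s /\ m <= p.2.
Proof.
elim: s m => [|x s IHs] m //= [<-|/IHs[ps mp]] /=; first by split; [left|].
by split; [right | apply: ltnW].
Qed.

Lemma zip_iota_in (T : Type) (s : seq T) (m : nat) (x : T) :
  List.In x s -> exists i, List.In (x, i) (zip s (iota m (size s))).
Proof.
elim: s m => [|z s IHs] m //= [->|/(IHs m.+1)[i xi]]; first by exists m; left.
by exists i; right.
Qed.

(** Choosing by position lets equal elements at different positions receive different witnesses. It
    will pick one realizer per premise; [u0] is only the default for an empty list. *)
Lemma zip_iota_choice (T U : Type) (Q : T -> U -> Prop) (u0 : U) (s : seq T)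
    (m : nat) :
  (forall x, List.In x s -> exists u, Q x u) ->
  exists u : nat -> U,
    forall p, List.In p (zip s (iota m (size s))) -> Q p.1 (u p.2).
Proof.
elim: s m => [|x s IHs] m Qs; first by exists (fun=> u0).
have [|u Qu] := IHs m.+1; first by move=> z zs; apply: Qs; right.
have [v Qv] : exists u, Q x u by apply: Qs; left.
exists (fun i => if i == m then v else u i) => p /= [<-|pz] /=.
  by rewrite eqxx.
have [_ mp] := in_zip_iota pz.
by rewrite gtn_eqF //; apply: Qu.
Qed.

(** * Terms, substitutions and variables *)

Section Terms.

Variable S : signature.
Implicit Types (t : term S) (s d g : nat -> term S) (A B : atom S).

Lemma term_nested_ind (P : term S -> Prop) :
  (forall x, P (Var x)) ->
  (forall f (a : {ffun 'I_(fun_arity f) -> term S}),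
     (forall i, P (a i)) -> P (App f a)) ->
  forall t, P t.
Proof.
move=> PVar PApp; fix IH 1 => -[x|f a]; first exact: PVar.
by apply: PApp => i; apply: IH.
Qed.

(** The constructor only gives an equality of dependent pairs over [f]; decidable equality of
    symbols lets the second components be compared. *)
Lemma App_inj (f : fun_sym S) (a b : {ffun 'I_(fun_arity f) -> term S}) :
  App f a = App f b -> a = b.
Proof.
by case=> eab; apply: inj_pair2_eq_dec eab => x y; apply: decP (x =P y).
Qed.

Lemma Atom_inj (P : pred_sym S) (a b : {ffun 'I_(pred_arity P) -> term S}) :
  Atom a = Atom b -> a = b.
Proof.
by case=> eab; apply: inj_pair2_eq_dec eab => x y; apply: decP (x =P y).
Qed.

Lemma mem_term_vars_App (f : fun_sym S) (a : {ffun 'I_(fun_arity f) -> term S})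
    i x :
  x \in term_vars (a i) -> x \in term_vars (App f a).
Proof. by move=> xa; apply/flatten_mapP; exists i; rewrite ?mem_enum. Qed.

Lemma mem_atom_vars A i x : x \in term_vars (args_of A i) -> x \in atom_vars A.
Proof. by move=> xA; apply/flatten_mapP; exists i; rewrite ?mem_enum. Qed.

Lemma eq_in_tsubst s1 s2 t :
  (forall x, x \in term_vars t -> s1 x = s2 x) -> tsubst s1 t = tsubst s2 t.
Proof.
elim/term_nested_ind: t => [x|f a IHa] eq_s /=; first exact/eq_s/mem_head.
congr App; apply/ffunP => i; rewrite !ffunE; apply: IHa => x xi.
exact/eq_s/(mem_term_vars_App xi).
Qed.

Lemma eq_in_asubst s1 s2 A :
  (forall x, x \in atom_vars A -> s1 x = s2 x) -> asubst s1 A = asubst s2 A.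
Proof.
move=> eq_s; congr Atom; apply/ffunP => i; rewrite !ffunE.
by apply: eq_in_tsubst => x xi; apply/eq_s/(mem_atom_vars xi).
Qed.

Lemma tsubst_comp s1 s2 t :
  tsubst s1 (tsubst s2 t) = tsubst (fun x => tsubst s1 (s2 x)) t.
Proof.
elim/term_nested_ind: t => [x|f a IHa] //=.
by congr App; apply/ffunP => i; rewrite !ffunE.
Qed.

Lemma asubst_comp s1 s2 A :
  asubst s1 (asubst s2 A) = asubst (fun x => tsubst s1 (s2 x)) A.
Proof. by congr Atom; apply/ffunP => i; rewrite !ffunE tsubst_comp. Qed.

Lemma term_vars_rename (r : nat -> nat) t x :
  x \in term_vars (tsubst (fun z => Var (r z)) t) -> exists z, x = r z.
Proof.
elim/term_nested_ind: t => [z|f a IHa] /=.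
  by rewrite inE => /eqP->; exists z.
by case/flatten_mapP => i _; rewrite ffunE; apply: IHa.
Qed.

Lemma horn_vars_rename (K : Type) (r : nat -> nat) (c : horn S K) x :
  x \in horn_vars (hsubst (fun z => Var (r z)) c) -> exists z, x = r z.
Proof.
case/mem_flatten_map => A.
case/(@in_map_inv _ _ (asubst _) (Defs.head c :: body c)) => B [-> _].
by case/flatten_mapP => i _; rewrite ffunE; apply: term_vars_rename.
Qed.

(** * Term size and the occurs check *)

Fixpoint term_size t : nat :=
  match t with
  | Var _ => 1
  | App f a => (sumn [seq term_size (a i) | i <- enum 'I_(fun_arity f)]).+1
  end.

Lemma term_size_gt0 t : 0 < term_size t.
Proof. by case: t. Qed.

Lemma term_size_arg (f : fun_sym S) (a : {ffun 'I_(fun_arity f) -> term S}) i :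
  term_size (a i) < term_size (App f a).
Proof.
rewrite /= ltnS sumnE big_map (big_rem i) ?leq_addr //.
by rewrite mem_enum.
Qed.

Lemma term_size_tsubst_arg d (f : fun_sym S)
    (a : {ffun 'I_(fun_arity f) -> term S}) i :
  term_size (tsubst d (a i)) < term_size (tsubst d (App f a)).
Proof.
by have := term_size_arg [ffun j => tsubst d (a j)] i; rewrite ffunE.
Qed.

Lemma term_size_occurs d t x :
  x \in term_vars t -> term_size (d x) <= term_size (tsubst d t).
Proof.
elim/term_nested_ind: t => [z|f a IHa]; first by rewrite inE => /eqP->.
case/flatten_mapP => i _ /IHa sz.
exact/(leq_trans sz)/ltnW/term_size_tsubst_arg.
Qed.

(** The strict inequality is the occurs check: no [d] can equate [x] with a compound term containing
    [x]. *)
Lemma term_size_occurs_App d (f : fun_sym S)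
    (a : {ffun 'I_(fun_arity f) -> term S}) x :
  x \in term_vars (App f a) ->
  term_size (d x) < term_size (tsubst d (App f a)).
Proof.
case/flatten_mapP => i _ /(term_size_occurs d) sz.
exact/(leq_ltn_trans sz)/term_size_tsubst_arg.
Qed.

(** * Unification of systems of equations *)

Definition solves d (E : seq (term S * term S)) : Prop :=
  forall e, List.In e E -> tsubst d e.1 = tsubst d e.2.

Definition most_general g (E : seq (term S * term S)) : Prop :=
  solves g E /\
  forall d, solves d E ->
    exists r : nat -> term S, forall x, d x = tsubst r (g x).

Lemma solves_cons d t u E :
  solves d ((t, u) :: E) <-> tsubst d t = tsubst d u /\ solves d E.
Proof.
split=> [dE|[dtu dE] e /= [<-|/dE]] //.
by split=> [|e eE]; [apply: (dE (t, u)); left | apply: dE; right].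
Qed.

Lemma most_general_equiv g E E' :
  (forall d, solves d E <-> solves d E') -> most_general g E ->
  most_general g E'.
Proof. by move=> eqE [gE gen]; split=> [|d /eqE/gen //]; apply/eqE. Qed.

Definition bind_var (x : nat) t : nat -> term S :=
  fun z => if z == x then t else Var z.

Lemma tsubst_bind_var d x t u :
  d x = tsubst d t -> tsubst d (tsubst (bind_var x t) u) = tsubst d u.
Proof.
move=> dx; rewrite tsubst_comp; apply: eq_in_tsubst => z _.
by rewrite /bind_var; case: eqP => [->|].
Qed.

Definition bind_eqn x t (e : term S * term S) :=
  (tsubst (bind_var x t) e.1, tsubst (bind_var x t) e.2).

Definition bind_eqns x t (E : seq (term S * term S)) :=
  [seq bind_eqn x t e | e <- E].

Lemma solves_bind_eqns d x t E :
  d x = tsubst d t -> solves d E <-> solves d (bind_eqns x t E).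
Proof.
move=> dx; split=> [dE e' Ee'|dE e eE].
  have [e [-> eE]] := in_map_inv Ee'.
  by rewrite /= !tsubst_bind_var //; apply: dE.
have := dE (bind_eqn x t e) (List.in_map _ _ _ eE).
by rewrite /= !tsubst_bind_var.
Qed.

(** Any solution [d] of [x = t] absorbs the binding of [x] to [t], so a factorization of [d] through
    [g] is also one through the composite. *)
Lemma most_general_bind g x t E :
  x \notin term_vars t -> most_general g (bind_eqns x t E) ->
  most_general (fun z => tsubst g (bind_var x t z)) ((Var x, t) :: E).
Proof.
move=> xt [gE gen]; split=> [|d /solves_cons[/= dx dE]].
  apply/solves_cons; split=> [/=|e eE].
    rewrite /bind_var eqxx; apply: eq_in_tsubst => z zt.
    by case: eqP => // zx; rewrite -zx zt in xt.
  rewrite -!tsubst_comp.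
  exact: (gE (bind_eqn x t e) (List.in_map _ _ _ eE)).
have [r dr] := gen _ (iffLR (solves_bind_eqns E dx) dE).
exists r => z; rewrite tsubst_comp -(eq_in_tsubst (s1 := d)); last first.
  by move=> w _; apply: dr.
by rewrite /bind_var; case: eqP => [->|].
Qed.

Lemma solves_args d n (a b : {ffun 'I_n -> term S}) :
  solves d [seq (a i, b i) | i <- enum 'I_n] <->
  [ffun i => tsubst d (a i)] = [ffun i => tsubst d (b i)].
Proof.
split=> [dab|/ffunP dab e eab]; last first.
  by have [i [-> _]] := in_map_inv eab; have := dab i; rewrite !ffunE.
apply/ffunP => i; rewrite !ffunE; apply: (dab (a i, b i)).
apply: (List.in_map (fun i => (a i, b i))).
have : i \in enum 'I_n by rewrite mem_enum.
elim: (enum _) => //= j r IHr; rewrite inE.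
by case/orP=> [/eqP->|/IHr]; [left|right].
Qed.

Lemma solves_App d (f : fun_sym S) (a b : {ffun 'I_(fun_arity f) -> term S}) E :
  solves d ([seq (a i, b i) | i <- enum 'I_(fun_arity f)] ++ E) <->
  solves d ((App f a, App f b) :: E).
Proof.
rewrite solves_cons; split=> [dE|[/= /App_inj/solves_args dab dE] e eabE].
  split=> [/=|e eE]; last by apply: dE; apply/List.in_or_app; right.
  congr App; apply/solves_args => e eab.
  by apply: dE; apply/List.in_or_app; left.
by case: (List.in_app_or _ _ _ eabE); [apply: dab | apply: dE].
Qed.

(** Measuring left-hand sides is enough: when [d] solves [E], both sides have the same instance. *)
Definition eqns_size d (E : seq (term S * term S)) : nat :=
  sumn [seq term_size (tsubst d e.1) | e <- E].

(* Binding a variable leaves the d-instance of the system unchanged, so the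
   size of this instance decreases at every step of the unification algorithm;
   no count of the remaining variables is needed. *)
Lemma mgu_system_exists d E : solves d E -> exists g, most_general g E.
Proof.
have [n] := ubnP (eqns_size d E); elim: n E => // n IHn [|[t u] E].
  by move=> _ _; exists Var; split=> // d' _; exists d'.
move=> ltn dtuE; have [dtu dE] := iffLR (solves_cons d t u E) dtuE.
have ltE : eqns_size d E < n.
  by move: ltn; rewrite /eqns_size /=; have := term_size_gt0 (tsubst d t); lia.
have elim_var x v : d x = tsubst d v -> x \notin term_vars v ->
    exists g, most_general g ((Var x, v) :: E).
  move=> dx xv.
  have [||g gE] := IHn (bind_eqns x v E); last first.
  - by exists (fun z => tsubst g (bind_var x v z)); apply: most_general_bind.
  - exact: (iffLR (solves_bind_eqns E dx) dE).
  - rewrite (_ : eqns_size _ _ = eqns_size d E) // /eqns_size -map_comp.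
    by congr sumn; apply: eq_map => e /=; rewrite tsubst_bind_var.
case: t u dtu dtuE ltn => [x|f a] [z|h b] dtu dtuE ltn.
- have [<-{z dtu dtuE ltn}|/eqP xz] := x =P z; last first.
    by apply: elim_var dtu _; rewrite inE.
  have [g gE] := IHn E ltE dE; exists g.
  by apply: most_general_equiv gE => d'; rewrite solves_cons; split=> [|[]].
- apply: (elim_var _ _ dtu); apply/negP => /(term_size_occurs_App d).
  by rewrite -dtu ltnn.
- have [||g gE] := elim_var z (App f a).
  + by rewrite dtu.
  + apply/negP => /(term_size_occurs_App d).
    by rewrite dtu ltnn.
  exists g; apply: most_general_equiv gE => d'.
  by rewrite !solves_cons; split=> -[-> ?].
have fh : f = h by case: dtu.
case: h / fh b dtu dtuE ltn => b _ dtuE ltn.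
have [||g gE] := IHn ([seq (a i, b i) | i <- enum 'I_(fun_arity f)] ++ E).
(* Decomposition removes the outer [f], which lowers the size by exactly one. *)
- move: ltn; rewrite /eqns_size /= map_cat sumn_cat ltnS; apply: leq_trans.
  rewrite -map_comp addSn ltnS leq_add2r.
  rewrite (_ : map _ _ = [seq term_size ([ffun i => tsubst d (a i)] i)
                           | i <- enum 'I_(fun_arity f)]) //.
  by apply: eq_map => i /=; rewrite ffunE.
- exact/solves_App.
by exists g; apply: most_general_equiv gE => d'; apply: solves_App.
Qed.

(** A unifier forces equal predicates, which reduces the question to the system of argument
    pairs. *)
Lemma mgu_exists d A B : unifier d A B -> exists g, mgu g A B.
Proof.
case: A B => [P a] [Q b]; rewrite /mgu /unifier => dAB.
have PQ : P = Q by case: dAB.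
case: Q / PQ b dAB => b dAB.
pose E := [seq (a i, b i) | i <- enum 'I_(pred_arity P)].
have solvesE s : solves s E <-> asubst s (Atom a) = asubst s (Atom b).
  by rewrite solves_args; split=> [sab|/Atom_inj //]; congr Atom.
have [g [gE gen]] := mgu_system_exists (iffRL (solvesE d) dAB).
by exists g; split=> [|d' /solvesE/gen //]; apply/solvesE.
Qed.

(** Shifting by a strict bound [N] on the goal variables separates the two sets of variables. The
    bound is exported so that substitutions can be glued at [N]. *)
Lemma exists_renamed_apart (K : Type) (G : seq (atom S)) (c : horn S K) :
  exists N : nat,
    (forall A, List.In A G -> forall x, x \in atom_vars A -> x < N) /\
    renamed_apart G c (hsubst (fun x => Var (N + x)) c).
Proof.
pose N := (\max_(x <- flatten [seq atom_vars A | A <- G]) x).+1.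
have ltN A : List.In A G -> forall x, x \in atom_vars A -> x < N.
  by move=> AG x xA; apply/leq_max_mem/mem_flatten_map; exists A.
exists N; split=> //; exists (addn N); split=> //; first exact: addnI.
move=> A AG x /horn_vars_rename[z ->]; apply/negP => /(ltN A AG).
by rewrite ltnNge leq_addr.
Qed.

End Terms.

(** * Derivation trees and LP-Unif reduction *)

Section Derivations.

Variables (S : signature) (K : Type) (Phi : seq (horn S K)).
Implicit Types (A B : atom S) (G : seq (atom S)).

Inductive derivable : atom S -> Prop :=
| Derivable (c : horn S K) (s : nat -> term S) of
    List.In c Phi &
    (forall B, List.In B (body c) -> derivable (asubst s B)) :
    derivable (asubst s (Defs.head c)).

(** A forest of derivation trees, linearized depth first, so that each constructor matches one
    reduction step on the first atom. *)
Inductive derivable_goal : seq (atom S) -> Prop :=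
| DerivableNil : derivable_goal [::]
| DerivableCons (c : horn S K) (s : nat -> term S) G of
    List.In c Phi &
    derivable_goal ([seq asubst s B | B <- body c] ++ G) :
    derivable_goal (asubst s (Defs.head c) :: G).

Lemma derivable_goal_cons A G :
  derivable A -> derivable_goal G -> derivable_goal (A :: G).
Proof.
(* Keeping [G] general allows the trees of the body atoms to be prepended one after another. *)
move=> dA; elim: dA G => {A} c s cPhi _ IH G dG.
apply: DerivableCons cPhi _; elim: (body c) IH => [|B Bs IHBs] IH //=.
apply: (IH B); first by left.
by apply: IHBs => B' B's; apply: (IH B'); right.
Qed.

Lemma lp_unif_sound G :
  lp_unif_star Phi G [::] ->
  exists s, forall A, List.In A G -> derivable (asubst s A).
Proof.
move/clos_rt_rt1n_iff; set G' := [::] => GG'.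
have : G' = [::] by [].
elim: GG' => {G G'} [G ->|G H G' step _ IH /IH{IH}[s dH]].
  by exists Var.
case: step => A R c c' g GAR cPhi [r [_ c'E _]] [gA _] HE.
(* The witness accumulates the unifiers of all steps: the computed answer substitution. *)
exists (fun x => tsubst s (g x)) => B /(Permutation_in _ GAR) BAR.
have {}dH D : List.In D (body c' ++ R) ->
    derivable (asubst (fun x => tsubst s (g x)) D).
  move=> DR; rewrite -asubst_comp; apply: dH.
  exact/(Permutation_in _ (Permutation_sym HE))/List.in_map.
case: BAR => [<-|BR]; last by apply/dH/List.in_or_app; right.
rewrite -asubst_comp -gA asubst_comp c'E /= asubst_comp.
apply: Derivable cPhi _ => D Dc; rewrite -asubst_comp; apply: dH.
by apply/List.in_or_app; left; rewrite c'E; apply: List.in_map.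
Qed.

Lemma derivable_goal_lift G s :
  derivable_goal [seq asubst s A | A <- G] -> lp_unif_star Phi G [::].
Proof.
(* The instance is abstracted to [L]: the induction follows its derivation while [G] and [s] change
   at each step. *)
move: {2}(map _ _) (erefl [seq asubst s A | A <- G]) => L LE; rewrite LE => dL.
elim: dL G s LE => {L} [|c th L cPhi _ IH] [|A R] s //=.
  by move=> _; apply: rt_refl.
move=> LE; have Ac : asubst s A = asubst th (Defs.head c).
  exact: (congr1 (seq.head (asubst s A)) LE).
have RL : [seq asubst s B | B <- R] = L by exact: (congr1 behead LE).
have [N [ltN apart]] := exists_renamed_apart (A :: R) c.
pose c' := hsubst (fun x => Var (N + x)) c.
(* Goal variables lie below [N] and renamed clause variables at or above it, so [d] acts as [s] on
   the goal and as [th] on the clause. *)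
pose d x := if x < N then s x else th (x - N).
have dR B : List.In B (A :: R) -> asubst d B = asubst s B.
  by move=> BR; apply: eq_in_asubst => x xB; rewrite /d (ltN B).
have dc B : asubst d (asubst (fun x => Var (N + x)) B) = asubst th B.
  rewrite asubst_comp; apply: eq_in_asubst => x _ /=.
  by rewrite /d ltnNge leq_addr /= addKn.
have dcA : unifier d (Defs.head c') A.
  by rewrite /unifier [LHS]dc dR; [rewrite Ac | left].
have [g mgu_g] := mgu_exists dcA.
(* The factor [r] instantiates the reduced goal to the remaining forest, and replaces [s] in the
   induction. *)
have [r dr] := mgu_g.2 d dcA.
have rg B : asubst r (asubst g B) = asubst d B.
  by rewrite asubst_comp; apply: eq_in_asubst => x _; rewrite dr.
apply: (rt_trans _ _ _ [seq asubst g B | B <- body c' ++ R]).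
  apply: rt_step; apply: (@LpUnif _ _ _ _ _ A R c c' g) => //.
apply: (IH _ r); rewrite -map_comp map_cat; congr (_ ++ _).
  by rewrite -map_comp; apply: eq_map => B /=; rewrite rg dc.
by rewrite -RL; apply: eq_in_map_In => B BR /=; rewrite rg dR //; right.
Qed.

Lemma lp_unif_star_iff_derivable A :
  lp_unif_star Phi [:: A] [::] <-> exists s, derivable (asubst s A).
Proof.
split=> [/lp_unif_sound[s dA]|[s dA]]; first by exists s; apply: dA; left.
apply: (@derivable_goal_lift _ s).
by apply: derivable_goal_cons => //; apply: DerivableNil.
Qed.

End Derivations.

(** * Derivations across the realizability transformation *)

Section Realizability.

Variables (S : signature) (K : eqType) (Phi : seq (horn S K)).
Implicit Types (A B : atom S) (t : term S).

Local Notation S' := (real_sig Phi).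

Lemma embed_tsubst (s : nat -> term S) (d : nat -> term S') t :
  (forall x, x \in term_vars t -> d x = embed Phi (s x)) ->
  tsubst d (embed Phi t) = embed Phi (tsubst s t).
Proof.
elim/term_nested_ind: t => [x|f a IHa] eq_d /=; first exact/eq_d/mem_head.
congr App; apply/ffunP => i; rewrite !ffunE; apply: IHa => x xi.
exact/eq_d/(mem_term_vars_App xi).
Qed.

(** Only the variables of [A] are constrained, which leaves [d] free on a fresh variable in [u]. *)
Lemma asubst_add_arg (s : nat -> term S) (d : nat -> term S') A (u : term S') :
  (forall x, x \in atom_vars A -> d x = embed Phi (s x)) ->
  asubst d (add_arg A u) = add_arg (asubst s A) (tsubst d u).
Proof.
move=> eq_d; congr (@Atom S' (pred_of A)); apply/ffunP => i; rewrite !ffunE.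
case: unliftP => [j _|_] //=; rewrite ffunE.
by apply: embed_tsubst => x xj; apply/eq_d/(mem_atom_vars xj).
Qed.

(* Terms headed by some f_k carry no information about Phi; Var 0 is an
   arbitrary value. *)
Fixpoint erase (t : term S') : term S :=
  match t with
  | Var x => Var x
  | App f a =>
      match f return ({ffun 'I_(@fun_arity S' f) -> term S'} -> term S) with
      | inl g => fun a => App g [ffun i => erase (a i)]
      | inr _ => fun _ => Var 0
      end a
  end.

Definition erase_arg (A : atom S') : atom S :=
  @Atom S (pred_of A) [ffun i => erase (args_of A (lift ord_max i))].

(** No f_k occurs in [embed Phi t], so [erase] can collapse subterms only inside the values of
    [d]. *)
Lemma erase_tsubst_embed (d : nat -> term S') t :
  erase (tsubst d (embed Phi t)) = tsubst (fun x => erase (d x)) t.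
Proof.
elim/term_nested_ind: t => [x|f a IHa] //=.
by congr App; apply/ffunP => i; rewrite !ffunE.
Qed.

Lemma erase_arg_asubst (d : nat -> term S') A (u : term S') :
  erase_arg (asubst d (add_arg A u)) = asubst (fun x => erase (d x)) A.
Proof.
congr (@Atom S (pred_of A)); apply/ffunP => i; rewrite !ffunE.
by rewrite liftK erase_tsubst_embed.
Qed.

Lemma derivable_erase_arg (A : atom S') :
  derivable (realizability Phi) A -> derivable Phi (erase_arg A).
Proof.
elim=> {A} c' d c'F _; have [c [-> cPhi]] := in_map_inv c'F => IH.
rewrite [Defs.head _]/= erase_arg_asubst; apply: Derivable cPhi _ => B Bc.
have [i Bi] := zip_iota_in 0 Bc.
rewrite -(erase_arg_asubst d B (Var (fresh_var c i))); apply: IH.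
exact: (List.in_map _ _ _ Bi).
Qed.

Lemma derivable_add_arg A :
  derivable Phi A ->
  exists u : term S', derivable (realizability Phi) (add_arg A u).
Proof.
elim=> {A} c s cPhi _ IH.
have [u uP] := zip_iota_choice (Var 0) 0 IH.
pose N := fresh_var c 0.
(* Clause variables lie below [N] and y_(i+1) is [N + i]: [d] follows [s] on the former and sends
   the latter to [u i], the realizer of the premise at position [i]. *)
pose d x : term S' := if x < N then embed Phi (s x) else u (x - N).
have d_fresh i : d (fresh_var c i) = u i.
  have fN : fresh_var c i = N + i by rewrite /N /fresh_var addn0.
  by rewrite fN /d ltnNge leq_addr /= addKn.
have d_clause A : List.In A (Defs.head c :: body c) ->
    forall x, x \in atom_vars A -> d x = embed Phi (s x).
  move=> Ac x xA; rewrite /d ifT // /N /fresh_var addn0 ltnS.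
  by apply/leq_max_mem/mem_flatten_map; exists A.
(* The realizer of the conclusion is f_k applied to the realizers of the premises. *)
exists (tsubst d (@App S' (inr (label c))
  [ffun i : 'I_(premises Phi (label c)) => Var (fresh_var c i)])).
rewrite -(asubst_add_arg _ (d_clause _ (or_introl erefl))).
apply: (@Derivable _ _ _ (real_horn Phi c) d).
  exact: List.in_map.
move=> B' B'c; have [p [-> pc]] := in_map_inv B'c.
have [pB _] := in_zip_iota pc.
rewrite (asubst_add_arg _ (d_clause _ (or_intror pB))) /= d_fresh.
exact: uP.
Qed.

End Realizability.

Theorem theorem6 (S : signature) (K : eqType) (Phi : seq (horn S K))
    (hPhi : distinct_labels Phi) (A : atom S) (y : nat)
    (hy : y \notin atom_vars A) :
  lp_unif_star Phi [:: A] [::] <->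
  lp_unif_star (realizability Phi)
    [:: add_arg A (Var y : term (real_sig Phi))] [::].
Proof.
rewrite !lp_unif_star_iff_derivable.
split=> [[s /derivable_add_arg[u dA]]|[d /derivable_erase_arg]].
  (* As [y] does not occur in [A], it can be sent to the realizer [u] without disturbing the
     instance of [A]. *)
  exists (fun x => if x == y then u else embed Phi (s x)).
  rewrite (asubst_add_arg (s := s)) /= ?eqxx // => x xA.
  by case: eqP => // xy; rewrite -xy xA in hy.
by rewrite erase_arg_asubst => dA; exists (fun x => erase (d x)).
Qed.
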